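(* Let $n\ge 1$ and let $S=(s_{i,j})_{i,j=1}^n$ be a real symmetric matrix with non-negative entries such that for all $i,j\in\{1,\ldots,n\}$: $s_{i,j}>0$ if $i+j=n$; $s_{i,j}>0$ if $i+j=n+1$; and $s_{i,j}=0$ if $i+j\ge n+2$. Let $m=(m_1,\ldots,m_n):\mathbb{H}\to\mathbb{H}^n$ be the solution of the vector Dyson equation $-\frac{1}{m(z)}=z+Sm(z)$. Then there exist positive constants $c_1,\ldots,c_n$ such that for all $k\in\{1,\ldots,n\}$ $$\lim_{z\to 0,\ z\in\mathbb{H}} \left(m_k(z)\,z^{-\left(1-\frac{2k}{n+1}\right)}\right) = c_k\,e^{i\frac{\pi k}{n+1}},$$ where the branch of $z^{-\left(1-\frac{2k}{n+1}\right)}$ in $\mathbb{H}$ is chosen so that it is positive for positive $z$.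
   Context: $\mathbb{H}$ is the open complex upper half-plane. The vector Dyson equation $-1/m=z+Sm$ is understood entrywise: $-1/m_k(z)=z+\sum_{j=1}^n s_{k,j}m_j(z)$ for all $k$ and all $z\in\mathbb{H}$. It is known that for every $z\in\mathbb{H}$ it has a unique solution $m(z)\in\mathbb{H}^n$. The branch is $z^{\alpha}=|z|^{\alpha}e^{i\alpha\arg z}$ with $\arg z\in(0,\pi)$ for $z\in\mathbb{H}$. *)

(* Defs.v *)
From mathcomp Require Import all_boot all_order all_algebra.
From mathcomp Require Import complex.
From mathcomp Require Import all_classical all_reals all_analysis.

Set Implicit Arguments.
Unset Strict Implicit.
Unset Printing Implicit Defensive.

Import Order.TTheory GRing.Theory Num.Theory.
Import numFieldNormedType.Exports.

Local Open Scope classical_set_scope.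
Local Open Scope complex_scope.
Local Open Scope ring_scope.

(* [complex.Re] and [complex.Im] are qualified because [Re] and [Im] are also
   the R[i]-valued functions of [numClosedFieldType]. *)

Definition upper_half_plane (R : realType) : set R[i] :=
  [set z | 0 < complex.Im z].

(* e^{i t} for real t *)
Definition expi (R : realType) (t : R) : R[i] := cos t +i* sin t.

(* The principal argument, in ]-pi, pi] (junk at z = 0); it lies in ]0, pi[
   on the upper half-plane. *)
Definition carg (R : realType) (z : R[i]) : R :=
  if 0 <= complex.Im z then acos (complex.Re z / Normc.normc z)
  else - acos (complex.Re z / Normc.normc z).

(* |z|^a e^{i a arg z}, the branch of z^a that is positive for z > 0 *)
Definition cpow (R : realType) (z : R[i]) (a : R) : R[i] :=
  (Normc.normc z `^ a)%:C * expi (a * carg z).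

Definition dyson_solution (R : realType) (n : nat) (S : 'M[R]_n)
    (m : R[i] -> 'cV[R[i]]_n) : Prop :=
  forall z, upper_half_plane z -> forall k : 'I_n,
    upper_half_plane (m z k 0) /\
    - (m z k 0)^-1 = z + \sum_(j < n) (S k j)%:C * m z j 0.

(* Main.v *)
Require Import Defs.
From mathcomp Require Import all_boot all_order all_algebra.
From mathcomp Require Import complex.
From mathcomp Require Import all_classical all_reals all_analysis.
From mathcomp Require Import ring lra zify.

Import Order.TTheory GRing.Theory Num.Theory.
Import numFieldNormedType.Exports.

Local Open Scope classical_set_scope.
Local Open Scope complex_scope.
Local Open Scope ring_scope.

(** Write M_k = |m_k|. The imaginary part of the Dyson equation says that the
    positive vector with entries Im m_k / M_k is not increased by the symmetric
    non-negative matrix F_kj = M_k s_kj M_j. By Schur's test F is a contraction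
    of l2, whatever z is ([saturation_contraction]); in particular all its
    entries are at most 1, and |z| M_k is bounded. All the quantities in the
    equation divided by its modulus are thus bounded, and along an ultrafilter
    converging to 0 they have limits. The limit equation is rigid: because F is
    a contraction, the indices for which |z| M_k does not vanish in the limit
    would have to be matched, through the anti-diagonal, with equally many
    indices on which the norm of F is already exhausted, and nothing is left
    for z m_k ([heavy_indices_vanish]); then the rows of the limit of F sum to
    1, and since this matrix vanishes below the anti-diagonal it must be the
    anti-diagonal permutation matrix ([antitriangular_stochastic]). Hence
    z m_k -> 0, s_kj m_k m_j -> 0 for k + j <= n and
    s_(k,n+1-k) m_k m_(n+1-k) -> -1.

    The next order comes from comparing rows k and n+1-k of the equation
    multiplied by m_k: their leading terms coincide, so the remainders are equal,
    and these are dominated by the entries on k + j = n. Put w_0 = z, w_k = m_k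
    and w_(n+1) = -1/z. The comparison shows that the ratios w_(k+1) / w_k all
    have, up to explicit positive factors, the same asymptotics ([ratio_cvg]).
    Their product is -1 / z^2, so each of them is of order z^(-2/(n+1)), up to
    an (n+1)-st root of unity.

    The root of unity is fixed by the arguments. The increments of arg w_k lie in
    ]-pi, pi[ and agree modulo 2 pi in the limit. Since the entry F_n1 is at
    most 1, the number 1 + z m_n lies in the unit disc, so that Re (z m_n) <= 0
    and the last increment lies in [-pi/2, pi/2]. The others differ from
    it by less than 3 pi / 2, hence not by a full turn ([increment_cvg]).
    They add up to pi - 2 arg z, hence each is close to (pi - 2 arg z)/(n+1).
    *)

(** * Symmetric non-negative contractions *)

Section Contractions.
Context {R : realFieldType} {n : nat}.
Implicit Types (F : 'I_n -> 'I_n -> R) (x y g f t : 'I_n -> R).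

Definition mulv F x k : R := \sum_j F k j * x j.

Definition l2_contraction F :=
  forall x, \sum_k mulv F x k ^+ 2 <= \sum_k x k ^+ 2.

(** Cauchy-Schwarz in each row, with the weights F_kj f_j, and summation over
    the rows with the weights f_k: the positive vector f bounds both the row and
    the column sums. *)
Lemma schur_test F f : (forall i j, F i j = F j i) -> (forall i j, 0 <= F i j) ->
  (forall k, 0 < f k) -> (forall k, mulv F f k <= f k) -> l2_contraction F.
Proof.
move=> Fsym F0 f0 Ff x.
have row k : mulv F x k ^+ 2 <= f k * \sum_j F k j * (x j ^+ 2 / f j).
  set mu := mulv F x k; set q := \sum_j _.
  (* A weighted variance around mu; expanding it is the Cauchy-Schwarz bound. *)
  have : 0 <= \sum_j F k j * f j * (f k * (x j / f j) - mu) ^+ 2.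
    apply: sumr_ge0 => j _; apply: mulr_ge0; last exact: sqr_ge0.
    by apply: mulr_ge0 => //; exact: ltW.
  have expand c : \sum_j F k j * f j * (f k * (x j / f j) - c) ^+ 2 =
      f k ^+ 2 * q - 2 * f k * c * mulv F x k + c ^+ 2 * mulv F f k.
    rewrite /mulv /q !mulr_sumr -sumrN -!big_split /=.
    by apply: eq_bigr => j _; field; exact: lt0r_neq0.
  rewrite expand.
  have h : mu ^+ 2 * mulv F f k <= mu ^+ 2 * f k.
    by apply: ler_wpM2l => //; exact: sqr_ge0.
  rewrite -/mu => h1; rewrite -subr_ge0 -(pmulr_rge0 _ (f0 k)); move: h h1; nra.
apply: le_trans (ler_sum _ (fun k _ => row k)) _.
under eq_bigr do rewrite mulr_sumr.
rewrite exchange_big /=; apply: ler_sum => j _.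
have -> : \sum_i f i * (F i j * (x j ^+ 2 / f j)) =
          x j ^+ 2 / f j * mulv F f j.
  rewrite /mulv mulr_sumr; apply: eq_bigr => i _; rewrite (Fsym j i); ring.
rewrite -{2}(divfK (lt0r_neq0 (f0 j)) (x j ^+ 2)).
by apply: ler_wpM2l => //; rewrite divr_ge0 ?sqr_ge0 // ltW.
Qed.

Lemma contraction_entry F i j : l2_contraction F -> `|F i j| <= 1.
Proof.
move=> /(_ (fun k => (k == j)%:R)) cF.
have E k : mulv F (fun l => (l == j)%:R) k = F k j.
  rewrite /mulv (bigD1 j) //= eqxx mulr1 big1 ?addr0 // => l /negbTE ->.
  by rewrite mulr0.
rewrite -(@ler_pXn2r _ 2) ?nnegrE //= expr1n real_normK ?num_real //.
rewrite (le_trans _ (le_trans cF _)) //.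
  rewrite (bigD1 i) //= E lerDl; apply: sumr_ge0 => k _; exact: sqr_ge0.
by rewrite (bigD1 j) //= eqxx expr1n big1 ?addr0 // => l /negbTE ->; rewrite expr0n.
Qed.

(** When F almost preserves the norm of x, its square almost fixes x: the
    difference is controlled by the loss of norm, as F is self-adjoint. *)
Lemma contraction_fix F x : (forall i j, F i j = F j i) -> l2_contraction F ->
  \sum_k (mulv F (mulv F x) k - x k) ^+ 2 <=
  \sum_k x k ^+ 2 - \sum_k mulv F x k ^+ 2.
Proof.
move=> Fsym cF; have := cF (mulv F x).
have adj : \sum_k mulv F (mulv F x) k * x k = \sum_k mulv F x k ^+ 2.
  under eq_bigr do rewrite {1}/mulv mulr_suml.
  rewrite exchange_big /=; apply: eq_bigr => j _.
  rewrite expr2 [X in _ = _ * X]/mulv mulr_sumr; apply: eq_bigr => i _.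
  rewrite (Fsym i j); ring.
have -> : \sum_k (mulv F (mulv F x) k - x k) ^+ 2 =
    \sum_k mulv F (mulv F x) k ^+ 2
    - 2 * (\sum_k mulv F (mulv F x) k * x k) + \sum_k x k ^+ 2.
  rewrite mulr_sumr -sumrN -!big_split /=; apply: eq_bigr => k _; ring.
by rewrite adj; lra.
Qed.

(** The triangle inequality for the weighted sum of the unit vectors
    g_j + i f_j, in real coordinates. *)
Lemma sum_ge1_of_unit (w g f : 'I_n -> R) : (forall j, 0 <= w j) ->
  (forall j, g j ^+ 2 + f j ^+ 2 = 1) ->
  (\sum_j w j * g j) ^+ 2 + (\sum_j w j * f j) ^+ 2 = 1 -> 1 <= \sum_j w j.
Proof.
move=> w0 gf1; set G := \sum_j w j * g j; set H := \sum_j w j * f j => GH.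
rewrite -{1}GH.
have -> : G ^+ 2 + H ^+ 2 = \sum_j w j * (g j * G + f j * H).
  rewrite 2!expr2 {1}/G {1}/H !mulr_suml -big_split /=.
  by apply: eq_bigr => j _; ring.
apply: ler_sum => j _; rewrite -[leRHS]mulr1; apply: ler_wpM2l => //.
have := addr_ge0 (sqr_ge0 (g j - G)) (sqr_ge0 (f j - H)).
move: (gf1 j) GH; clearbody G H; lra.
Qed.

Lemma sum_ge0_le0_eq0 x : (forall k, 0 <= x k) -> \sum_k x k <= 0 ->
  forall k, x k = 0.
Proof.
move=> x0 s k; apply/eqP; rewrite eq_le x0 andbT; apply: le_trans s.
rewrite (bigD1 k) //= lerDl; exact: sumr_ge0.
Qed.

(** Here g + i f is the limit of m / |m|, t the limit of |z| M, zr + i zi that of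
    z / |z|, and r the reversal of indices. Let T be the support of t. On r(T),
    which has as many elements as T, the entries of g + i f are reproduced by F
    from those on T only, hence keep modulus 1. As F is a contraction, this
    consumes the whole norm of (g + i f) restricted to T: its image under F
    vanishes off r(T), and F maps this image back to the restriction. So F alone
    balances the equation on T, and t = 0 there.

    Cancellations could hide entries of F between T and the complement of r(T);
    applying the same norm count to the indicator of T excludes them. *)
Lemma heavy_indices_vanish F g f t (zr zi : R) (r : 'I_n -> 'I_n) :
  (forall i j, F i j = F j i) -> (forall i j, 0 <= F i j) -> l2_contraction F ->
  (forall k, g k ^+ 2 + f k ^+ 2 = 1) -> zr ^+ 2 + zi ^+ 2 = 1 ->
  (forall k, - g k = zr * t k + mulv F g k) ->
  (forall k, f k = zi * t k + mulv F f k) ->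
  involutive r -> (forall k, 0 <= t k) ->
  (forall k, 0 < t k -> t (r k) = 0) ->
  (forall k l, 0 < t k -> t l = 0 -> F (r k) l = 0) ->
  forall k, t k = 0.
Proof.
move=> Fsym F0 cF gf1 z1 Hg Hf rK t0 tr Frl.
(* Indicators of T and of r(T). *)
pose a k : R := (0 < t k)%R%:R; pose b k := a (r k).
have sab : \sum_k b k = \sum_k a k.
  by rewrite (reindex_inj (inv_inj rK)) /=; apply: eq_bigr => k _; rewrite /b rK.
have a2 k : a k ^+ 2 = a k by rewrite /a; case: (0 < t k); rewrite ?expr1n ?expr0n.
have a01 k : a k = 0 \/ a k = 1 by rewrite /a; case: (0 < t k); [right|left].
have aT k : a k = 1 -> 0 < t k.
  by rewrite /a; case: (0 < t k) => // /eqP; rewrite eq_sym oner_eq0.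
have aF k : a k = 0 -> t k = 0.
  rewrite /a; case: (boolP (0 < t k)) => [_ /eqP|]; first by rewrite oner_eq0.
  by rewrite -leNgt => h _; apply/eqP; rewrite eq_le h t0.
have bF i l : b i = 1 -> F i l * a l = F i l.
  move=> /aT bi; case: (a01 l) => al; rewrite al ?mulr1 //.
  by rewrite mulr0 -(rK i) Frl // aF.
have bt i : b i = 1 -> t i = 0 by move=> /aT /tr; rewrite rK.
(* x + i y is the restriction of g + i f to T; u k is the weight that row k of F
   puts on T. *)
pose x k := g k * a k; pose y k := f k * a k; pose u := mulv F a.
have u0 i : 0 <= u i.
  by apply: sumr_ge0 => j _; apply: mulr_ge0 => //; rewrite /a ler0n.
have xb i : b i = 1 -> mulv F x i = - g i.
  move=> bi; rewrite Hg (bt _ bi) mulr0 add0r; apply: eq_bigr => j _.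
  by rewrite /x mulrCA (bF _ _ bi) mulrC.
have yb i : b i = 1 -> mulv F y i = f i.
  move=> bi; rewrite Hf (bt _ bi) mulr0 add0r; apply: eq_bigr => j _.
  by rewrite /y mulrCA (bF _ _ bi) mulrC.
have ub i : b i = 1 -> 1 <= u i.
  move=> bi; apply: (@sum_ge1_of_unit _ g f) => // [j|].
    by apply: mulr_ge0 => //; rewrite /a ler0n.
  have E v : \sum_j F i j * a j * v j = mulv F (fun j => v j * a j) i.
    by apply: eq_bigr => j _; rewrite mulrAC -mulrA.
  by rewrite !E xb // yb // sqrrN.
have nFxy k : b k <= mulv F x k ^+ 2 + mulv F y k ^+ 2.
  case: (a01 (r k)) => bk; rewrite /b bk; first by rewrite addr_ge0 ?sqr_ge0.
  by rewrite xb // yb // sqrrN gf1.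
have nxy : \sum_k x k ^+ 2 + \sum_k y k ^+ 2 = \sum_k a k.
  rewrite -big_split /=; apply: eq_bigr => k _.
  by rewrite /x /y !exprMn -mulrDl gf1 mul1r a2.
have u2b k : u k ^+ 2 = b k.
  have h0 l : 0 <= u l ^+ 2 - b l.
    rewrite subr_ge0; case: (a01 (r l)) => bl; rewrite /b bl ?sqr_ge0 //.
    by rewrite expr_ge1 // ub.
  apply/eqP; rewrite -subr_eq0; apply/eqP; move: k.
  apply: sum_ge0_le0_eq0 => //; rewrite sumrB subr_le0 sab.
  by apply: le_trans (cF a) _; apply: ler_sum => k _; rewrite a2.
have Fal i l : b i = 0 -> F i l * a l = 0.
  move=> bi; move: l; apply: sum_ge0_le0_eq0 => [l|].
    by apply: mulr_ge0 => //; rewrite /a ler0n.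
  have /eqP := u2b i; rewrite bi expf_eq0 /= => /eqP ui.
  by rewrite -[X in X <= _]/(u i) ui.
have Fbg v k : a k = 1 -> mulv F (fun j => b j * v j) k = mulv F v k.
  move=> ak; apply: eq_bigr => j _; case: (a01 (r j)) => bj; last first.
    by rewrite /b bj mul1r.
  by have := Fal j k bj; rewrite ak mulr1 Fsym => ->; rewrite !mul0r.
have Fx k : mulv F x k = b k * - g k.
  case: (a01 (r k)) => bk; last by rewrite /b bk mul1r xb.
  rewrite /b bk mul0r; apply: big1 => j _.
  by rewrite /x mulrCA Fal // mulr0.
have Fy k : mulv F y k = b k * f k.
  case: (a01 (r k)) => bk; last by rewrite /b bk mul1r yb.
  rewrite /b bk mul0r; apply: big1 => j _.
  by rewrite /y mulrCA Fal // mulr0.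
have s0 : \sum_k ((mulv F (mulv F x) k - x k) ^+ 2
                 + (mulv F (mulv F y) k - y k) ^+ 2) <= 0.
  rewrite big_split /=; apply: le_trans (lerD (contraction_fix _ _ _ _)
    (contraction_fix _ _ _ _)) _ => //.
  rewrite addrACA nxy -opprD -big_split /= subr_le0 -sab.
  exact: ler_sum.
move=> k; apply/eqP; rewrite eq_le t0 andbT leNgt; apply/negP => tk.
have ak : a k = 1 by rewrite /a tk.
have := sum_ge0_le0_eq0 _ (fun k => addr_ge0 (sqr_ge0 _) (sqr_ge0 _)) s0 k.
have -> : mulv F (mulv F x) k = - mulv F g k.
  rewrite -(Fbg g) // /mulv -sumrN; apply: eq_bigr => j _.
  by rewrite -/(mulv F x j) Fx mulrN mulrN.
have -> : mulv F (mulv F y) k = mulv F f k.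
  by rewrite -(Fbg f) // /mulv; apply: eq_bigr => j _; rewrite -/(mulv F y j) Fy.
rewrite /x /y ak !mulr1 => h.
have : (zr * t k) ^+ 2 + (zi * t k) ^+ 2 = 0.
  have -> : zr * t k = - mulv F g k - g k by move: (Hg k); lra.
  have -> : zi * t k = - (mulv F f k - f k) by move: (Hf k); lra.
  by rewrite sqrrN.
by rewrite !exprMn -mulrDl z1 mul1r => /eqP; rewrite expf_eq0 gt_eqF.
Qed.

(** Each entry of g + i f has modulus 1 and is a combination of such entries,
    so every row sum is at least 1; the contraction property applied to the
    constant vector allows no more. *)
Lemma row_sums_eq1 F g f : (forall i j, 0 <= F i j) -> l2_contraction F ->
  (forall k, g k ^+ 2 + f k ^+ 2 = 1) ->
  (forall k, - g k = mulv F g k) -> (forall k, f k = mulv F f k) ->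
  forall k, \sum_j F k j = 1.
Proof.
move=> F0 cF gf1 Hg Hf.
have r1 k : 1 <= \sum_j F k j.
  apply: (@sum_ge1_of_unit _ g f) => //.
  by rewrite -[X in X ^+ 2]Hg -[X in _ + X ^+ 2]Hf sqrrN.
move=> k; have /eqP : (\sum_j F k j) ^+ 2 - 1 = 0.
  move: k; apply: sum_ge0_le0_eq0 => [k|].
    by rewrite subr_ge0 expr_ge1 // (le_trans ler01).
  rewrite sumrB subr_le0; apply: le_trans (le_trans (cF (fun=> 1)) _).
    rewrite le_eqVlt; apply/orP; left; apply/eqP; apply: eq_bigr => k _.
    by congr (_ ^+ 2); apply: eq_bigr => j _; rewrite mulr1.
  by apply: ler_sum => k _; rewrite expr1n.
rewrite subr_eq0 sqrf_eq1 => /orP[/eqP //|/eqP h].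
by have := r1 k; rewrite h; lra.
Qed.

(** Row n-1 has a single admissible entry, in column 0, which must be 1. By
    symmetry it fills row 0, which empties the remaining entries of the last
    column, so that row n-2 has in turn a single admissible entry, and so on. *)
Lemma antitriangular_stochastic F : (forall i j, F i j = F j i) ->
  (forall i j, 0 <= F i j) -> (forall k, \sum_j F k j = 1) ->
  (forall i j : 'I_n, (n <= i + j)%N -> F i j = 0) ->
  forall i j : 'I_n, j != rev_ord i -> F i j = 0.
Proof.
move=> Fsym F0 F1 Ftri i; have [N iN] := ubnP (i : nat).
elim: N i iN => // N IH i; rewrite ltnS => iN j jr.
have row0 l : l != i -> F (rev_ord i) l = 0.
  move=> li; have [ltil|leli] := ltnP i l.
    by apply: Ftri => /=; have := ltn_ord i; lia.
  have ltli : (l < i)%N by rewrite ltn_neqAle leli andbT.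
  rewrite Fsym IH //; first exact: leq_trans ltli iN.
  by rewrite (inj_eq rev_ord_inj) eq_sym.
have Fir : F i (rev_ord i) = 1.
  rewrite Fsym -(F1 (rev_ord i)) (bigD1 i) //= big1 ?addr0 //.
apply/eqP; rewrite eq_le F0 andbT.
have := F1 i; rewrite (bigD1 (rev_ord i)) //= Fir (bigD1 j) //= => h.
have : 0 <= \sum_(l | (l != rev_ord i) && (l != j)) F i l by exact: sumr_ge0.
by move: h; lra.
Qed.
End Contractions.

(** * Limits along ultrafilters *)

Section Ultrafilters.
Context {T : Type}.

Lemma ultra_bounded_cvg {R : realType} (U : set_system T) (f : T -> R) a b :
  UltraFilter U -> U [set x | a <= f x <= b] -> exists l : R, f x @[x --> U] --> l.
Proof.
move=> UU Uab.
have UF : ProperFilter U by exact: ultra_proper.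
have fUab : (f x @[x --> U]) `[a, b]%classic.
  apply: (@filterS _ U _ _ _ _ Uab) => x /=; by rewrite in_itv.
have [l [_ cl]] := segment_compact _ fUab.
exists l => V lV.
have [//|UV] := in_ultra_setVsetC (f @^-1` V) UU.
have [|x [nVx /nVx //]] := cl (~` V) V _ lV.
exact: (@filterS _ U _ _ _ _ UV).
Qed.

(** If f did not converge to l, some neighbourhood W of l would have a preimage
    outside F, and an ultrafilter refining F and the complement of that preimage
    would contradict the assumption. *)
Lemma cvg_ultra {V : topologicalType} (F : set_system T) (f : T -> V) (l : V) :
  Filter F ->
  (forall U, UltraFilter U -> F `<=` U -> f x @[x --> U] --> l) ->
  f x @[x --> F] --> l.
Proof.
move=> FF fU W lW; apply: contrapT => nFW.
pose G := within (~` (f @^-1` W)) F.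
have GF : ProperFilter G.
  split; last exact: within_filter.
  move=> G0; apply: nFW.
  have F0 : F [set x | ~ W (f x) -> False] by exact: G0.
  by apply: (@filterS _ F _ _ _ _ F0) => x /contrapT.
have [U [UU GU]] := ultraFilterLemma GF.
have UF : ProperFilter U by exact: ultra_proper.
have FU : F `<=` U.
  by move=> A FA; apply: GU; apply: (@filterS _ F FF _ _ _ FA) => x Ax _.
have UV : U (f @^-1` W) by exact: (fU U UU FU W lW).
have UnV : U (~` (f @^-1` W)) by apply: GU; exact: (@filterE _ F FF).
have : U set0 by rewrite -(setICr (f @^-1` W)); apply: filterI.
exact: filter_not_empty.
Qed.
End Ultrafilters.

(** * Complex numbers in polar form *)

Section ComplexFacts.
Context {R : realType}.
Implicit Types z w : R[i].
Local Notation Re := complex.Re.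
Local Notation Im := complex.Im.
Local Notation normc := Normc.normc.

Lemma cReM z w : Re (z * w) = Re z * Re w - Im z * Im w.
Proof. by case: z w => a b [c d]. Qed.

Lemma cImM z w : Im (z * w) = Re z * Im w + Im z * Re w.
Proof. by case: z w => a b [c d]. Qed.

Lemma cReD z w : Re (z + w) = Re z + Re w.
Proof. by case: z w => a b [c d]. Qed.

Lemma cImD z w : Im (z + w) = Im z + Im w.
Proof. by case: z w => a b [c d]. Qed.

Lemma cReN z : Re (- z) = - Re z. Proof. by case: z. Qed.
Lemma cImN z : Im (- z) = - Im z. Proof. by case: z. Qed.

Lemma cRe_sum I (r : seq I) (P : pred I) (F : I -> R[i]) :
  Re (\sum_(i <- r | P i) F i) = \sum_(i <- r | P i) Re (F i).
Proof. exact: (big_morph _ cReD). Qed.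

Lemma cIm_sum I (r : seq I) (P : pred I) (F : I -> R[i]) :
  Im (\sum_(i <- r | P i) F i) = \sum_(i <- r | P i) Im (F i).
Proof. exact: (big_morph _ cImD). Qed.

Lemma normc_sqr z : normc z ^+ 2 = Re z ^+ 2 + Im z ^+ 2.
Proof. by case: z => a b /=; rewrite sqr_sqrtr ?addr_ge0 ?sqr_ge0. Qed.

Lemma cReV z : Re z^-1 = Re z / normc z ^+ 2.
Proof. by rewrite normc_sqr; case: z. Qed.

Lemma cImV z : Im z^-1 = - (Im z / normc z ^+ 2).
Proof. by rewrite normc_sqr; case: z. Qed.

Lemma normc_ge0 z : 0 <= normc z.
Proof. by case: z => a b; exact: sqrtr_ge0. Qed.

Lemma normc_gt0 z : (0 < normc z) = (z != 0).
Proof.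
rewrite lt_def normc_ge0 andbT; congr (~~ _).
by apply/eqP/eqP => [/Normc.eq0_normc|->]; rewrite ?Normc.normc0.
Qed.

Lemma normc_sum I (r : seq I) (P : pred I) (F : I -> R[i]) :
  normc (\sum_(i <- r | P i) F i) <= \sum_(i <- r | P i) normc (F i).
Proof.
apply: (big_ind2 (fun x y => normc x <= y)) => [|x1 x2 y1 y2 h1 h2|//].
  by rewrite Normc.normc0.
exact: le_trans (le_normcD _ _) (lerD h1 h2).
Qed.

Lemma normc_real (x : R) : normc x%:C = `|x|.
Proof. by rewrite /= expr0n addr0 sqrtr_sqr. Qed.

Lemma upper_neq0 z : upper_half_plane z -> z != 0.
Proof. by rewrite /upper_half_plane /=; apply: contraTneq => ->; rewrite ltxx. Qed.
End ComplexFacts.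

Section Limits.
Context {R : realType} {T : Type}.
Local Notation normc := Normc.normc.

Lemma cvg_complexP (F : set_system T) (FF : Filter F)
    (f : T -> R[i]) (l : R[i]) :
  f x @[x --> F] --> (l : R[i]^o) <-> normc (f x - l) @[x --> F] --> (0 : R).
Proof.
have E x : `|l - f x| = (normc (f x - l))%:C.
  by rewrite distrC.
split => [fl|fl].
  apply/(@cvgr0Pnorm_lt R R) => e e0.
  have e0' : 0 < e%:C by rewrite ltcR.
  move/(@cvgrPdist_lt _ R[i]^o)/(_ _ e0'): fl; apply: (@filterS _ F FF) => x.
  by rewrite E ltcR ger0_norm ?normc_ge0.
apply/(@cvgrPdist_lt _ R[i]^o) => e e0.
have eE : e = (complex.Re e)%:C.
  by move: e0; rewrite ltcE => /andP[/eqP]; case: e => a b /= ->.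
have e0' : 0 < complex.Re e by rewrite -ltcR -eE.
move/(@cvgrPdist_lt R R)/(_ _ e0'): fl; apply: (@filterS _ F FF) => x.
by rewrite E sub0r normrN ger0_norm ?normc_ge0 // eE ltcR.
Qed.

Lemma cvg_near_le (F : set_system T) (f g : T -> R) (a b : R) :
  ProperFilter F -> f x @[x --> F] --> a -> g x @[x --> F] --> b ->
  F [set x | f x <= g x] -> a <= b.
Proof.
move=> FF fa gb fg; rewrite -subr_ge0.
apply: (cvgr_to_ge (cvgB gb fa)); apply: (@filterS _ F _ _ _ _ fg) => x /=.
by rewrite fctE subr_ge0.
Qed.

Lemma cvg_near_unique (F : set_system T) (f g : T -> R) (a b : R) :
  ProperFilter F -> f x @[x --> F] --> a -> g x @[x --> F] --> b ->
  F [set x | f x = g x] -> a = b.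
Proof.
move=> FF fa gb fg; apply/eqP; rewrite eq_le; apply/andP; split.
  by apply: (cvg_near_le _ _ _ _ _ _ fa gb); apply: (@filterS _ F _ _ _ _ fg) => x /= ->.
by apply: (cvg_near_le _ _ _ _ _ _ gb fa); apply: (@filterS _ F _ _ _ _ fg) => x /= ->.
Qed.

Lemma cvg_mulv {n} (F : set_system T) (A : T -> 'I_n -> 'I_n -> R) x B y k :
  Filter F -> (forall i j, A t i j @[t --> F] --> B i j) ->
  (forall j, x t j @[t --> F] --> y j) ->
  mulv (A t) (x t) k @[t --> F] --> mulv B y k.
Proof.
move=> FF AB xy; apply: (cvg_big add_continuous) => j _.
exact: cvgM.
Qed.
End Limits.

Section Polar.
Context {R : realType}.
Local Notation Re := complex.Re.
Local Notation Im := complex.Im.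
Local Notation normc := Normc.normc.
Implicit Types (z : R[i]) (a b : R).

Lemma expiD a b : expi (a + b) = expi a * expi b.
Proof.
apply/eqP; rewrite eq_complex /= cosD sinD; apply/andP; split => //.
by apply/eqP; ring.
Qed.

Lemma Re_div_normc z : z != 0 -> -1 <= Re z / normc z <= 1.
Proof.
move=> z0; have n0 : 0 < normc z by rewrite normc_gt0.
rewrite ler_pdivlMr // ler_pdivrMr // mulN1r mul1r -ler_norml.
rewrite -(@ler_pXn2r _ 2) ?nnegrE ?normc_ge0 //.
by rewrite real_normK ?num_real // normc_sqr lerDl sqr_ge0.
Qed.

Lemma carg_upper z : upper_half_plane z -> 0 < carg z < pi.
Proof.
move=> zu; have z0 := upper_neq0 _ zu.
have /andP[l1 l2] := Re_div_normc _ z0.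
have n0 : 0 < normc z by rewrite normc_gt0.
have ns : normc z ^+ 2 = Re z ^+ 2 + Im z ^+ 2 := normc_sqr z.
have i0 : 0 < Im z := zu.
rewrite /carg ltW //; apply/andP; split.
  apply: acos_gt0; rewrite l1 /= ltr_pdivrMr // mul1r.
  nra.
apply: acos_ltpi; rewrite l2 andbT ltr_pdivlMr // mulN1r.
nra.
Qed.

Lemma polar z : upper_half_plane z -> z = (normc z)%:C * expi (carg z).
Proof.
move=> zu; have z0 := upper_neq0 _ zu.
have l := Re_div_normc _ z0.
have n0 : 0 < normc z by rewrite normc_gt0.
have ns : normc z ^+ 2 = Re z ^+ 2 + Im z ^+ 2 := normc_sqr z.
have i0 : 0 < Im z := zu.
apply/eqP; rewrite eq_complex cReM cImM /= !mul0r subr0 addr0 /carg ltW //.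
rewrite acosK ?in_itv //= sin_acos //; apply/andP; split.
  by apply/eqP; field; rewrite gt_eqF.
have -> : 1 - (Re z / normc z) ^+ 2 = (Im z / normc z) ^+ 2.
  rewrite !expr_div_n -{1}(@divff _ (normc z ^+ 2)) ?expf_neq0 ?gt_eqF //.
  by rewrite -mulrBl ns; congr (_ / _); ring.
rewrite sqrtr_sqr ger0_norm; last by rewrite divr_ge0 ?ltW.
by apply/eqP; field; rewrite gt_eqF.
Qed.

Lemma carg_oppV z : upper_half_plane z -> carg (- z^-1) = pi - carg z.
Proof.
move=> zu; have z0 := upper_neq0 _ zu.
have n0 : 0 < normc z by rewrite normc_gt0.
have i0 : 0 < Im z := zu.
rewrite /carg cImN cImV cReN cReV opprK normcN Normc.normcV.
rewrite divr_ge0 ?exprn_ge0 1?ltW // -acosN ?Re_div_normc //.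
by congr acos; field; rewrite gt_eqF.
Qed.

Lemma upper_oppV z : upper_half_plane z -> upper_half_plane (- z^-1).
Proof.
move=> zu; have z0 := upper_neq0 _ zu.
rewrite /upper_half_plane /= cImN cImV opprK divr_gt0 //.
by rewrite exprn_gt0 // normc_gt0.
Qed.

Lemma cos_ge0_le_pihalf a : `|a| <= pi -> 0 <= cos a -> `|a| <= pi / 2.
Proof.
move=> api; rewrite -cos_norm leNgt => c0; rewrite leNgt; apply: contra c0 => h.
have := pi_gt0 R => p0.
by rewrite -cos_pihalf ltr_cos ?in_itv //=; apply/andP; split; lra.
Qed.

(* no wrap-around *)
(** An angle whose cosine tends to 1 approaches the multiples of 2 pi; below
    3 pi / 2 in absolute value, only 0 is available, with some margin: between pi
    and 3 pi / 2 the cosine is not even positive. *)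
Lemma cvg0_of_cos {T : Type} (F : set_system T) (f : T -> R) : Filter F ->
  F [set x | `|f x| < pi + pi / 2] -> cos (f x) @[x --> F] --> (1 : R) ->
  f x @[x --> F] --> (0 : R).
Proof.
move=> FF fb cf; apply/(@cvgr0Pnorm_lt R R) => e e0.
have p0 := pi_gt0 R.
pose e' := Num.min e pi.
have e'0 : 0 < e' by rewrite lt_min e0 p0.
have e'pi : e' <= pi by rewrite ge_min lexx orbT.
have ce : Num.max 0 (cos e') < 1.
  by rewrite gt_max ltr01 /= -cos0 ltr_cos ?in_itv //= ?lexx; lra.
have := @cvgr_gt _ _ _ FF _ _ cf _ ce.
move: fb; apply: filterS2 => x /= fx; rewrite gt_max -cos_norm => /andP[c1 c2].
have fpi : `|f x| <= pi.
  rewrite leNgt; apply/negP => h; move: c1; rewrite ltNge => /negP; apply.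
  rewrite -(subrK pi `|f x|) cosDpi oppr_le0; apply: cos_ge0_pihalf.
  by apply/andP; split; lra.
move: c2; rewrite ltr_cos ?in_itv /= ?e'pi ?normr_ge0 ?fpi ?(ltW e'0) // => h.
by rewrite (lt_le_trans h) // ge_min lexx.
Qed.

Lemma complex_cvg_ReIm {T : Type} (F : set_system T) (f : T -> R[i]) (l : R[i]) :
  Filter F -> Re (f x) @[x --> F] --> Re l -> Im (f x) @[x --> F] --> Im l ->
  f x @[x --> F] --> (l : R[i]^o).
Proof.
move=> FF fr fi; apply/cvg_complexP.
have l1 : `|Re (f x) - Re l| + `|Im (f x) - Im l| @[x --> F] -->
    `|Re l - Re l| + `|Im l - Im l|.
  by apply: cvgD; apply: cvg_norm; apply: cvgB => //; exact: cvg_cst.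
have l0 : (0 : R) @[x --> F] --> (0 : R) by exact: cvg_cst.
rewrite !subrr normr0 addr0 in l1.
apply: (squeeze_cvgr _ l0 l1); apply: filterE => x.
rewrite normc_ge0 /=; set u := f x - l.
have -> : Re (f x) - Re l = Re u by rewrite cReD cReN.
have -> : Im (f x) - Im l = Im u by rewrite cImD cImN.
rewrite -(@ler_pXn2r _ 2) ?nnegrE ?addr_ge0 ?normc_ge0 //.
rewrite normc_sqr sqrrD !real_normK ?num_real // addrAC lerDl.
by rewrite mulrn_wge0 // mulr_ge0.
Qed.

Lemma expi_cvg {T : Type} (F : set_system T) (f : T -> R) (l : R) :
  Filter F -> f x @[x --> F] --> l -> expi (f x) @[x --> F] --> (expi l : R[i]^o).
Proof.
move=> FF fl; apply: complex_cvg_ReIm => /=; apply: continuous_cvg => //.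
  exact: continuous_cos.
exact: continuous_sin.
Qed.

Lemma real_complex_cvg {T : Type} (F : set_system T) (f : T -> R) (l : R) :
  Filter F -> f x @[x --> F] --> l -> (f x)%:C @[x --> F] --> (l%:C : R[i]^o).
Proof. by move=> FF fl; apply: complex_cvg_ReIm => //=; exact: cvg_cst. Qed.

Lemma Re_cvg {T : Type} (F : set_system T) (f : T -> R[i]) (l : R[i]) :
  Filter F -> f x @[x --> F] --> (l : R[i]^o) -> Re (f x) @[x --> F] --> Re l.
Proof.
move=> FF /cvg_complexP fl; apply/(@cvgrPdist_lt R R) => e e0.
move/(@cvgr0Pnorm_lt R R)/(_ e e0): fl; apply: filterS => x.
apply: le_lt_trans; rewrite (ger0_norm (normc_ge0 _)) distrC.
set u := f x - l; have -> : Re (f x) - Re l = Re u by rewrite cReD cReN.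
rewrite -(@ler_pXn2r _ 2) ?nnegrE ?normc_ge0 //.
by rewrite real_normK ?num_real // normc_sqr lerDl sqr_ge0.
Qed.

Lemma normc_cvg {T : Type} (F : set_system T) (f : T -> R[i]) (l : R[i]) :
  Filter F -> f x @[x --> F] --> (l : R[i]^o) ->
  normc (f x) @[x --> F] --> normc l.
Proof.
move=> FF /cvg_complexP fl; apply/(@cvgrPdist_lt R R) => e e0.
move/(@cvgr0Pnorm_lt R R)/(_ e e0): fl; apply: filterS => x.
apply: le_lt_trans; rewrite (ger0_norm (normc_ge0 _)) distrC ler_norml.
have h1 := le_normcD (f x - l) l; have h2 := le_normcD (l - f x) (f x).
rewrite !subrK in h1 h2; rewrite -opprB normcN in h2.
by apply/andP; split; lra.
Qed.

Lemma powR_cvg {T : Type} (F : set_system T) (f : T -> R) (l a : R) :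
  Filter F -> 0 < l -> f x @[x --> F] --> l -> f x `^ a @[x --> F] --> l `^ a.
Proof.
move=> FF l0 fl.
have E y : 0 < y -> y `^ a = expR (a * ln y) by move=> y0; rewrite /powR gt_eqF.
have nz : F [set x | expR (a * ln (f x)) = f x `^ a].
  have h := @cvgr_gt _ _ _ FF _ _ fl _ l0.
  by move: h; apply: filterS => x /= h; rewrite E.
apply: cvg_trans (_ : expR (a * ln (f x)) @[x --> F] --> l `^ a).
  by apply: near_eq_cvg; move: nz; apply: filterS => x /= ->.
rewrite E //; apply: continuous_cvg; first exact: continuous_expR.
apply: cvgM; first exact: cvg_cst.
by apply: continuous_cvg => //; exact: continuous_ln.
Qed.

End Polar.

Section PolarQuotients.
Context {R : realType}.
Local Notation normc := Normc.normc.

Lemma expi_div (r t a b : R) : t != 0 ->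
  (r%:C * expi a) / (t%:C * expi b) = (r / t)%:C * expi (a - b).
Proof.
move=> t0; have b0 : expi b != 0.
  apply/eqP => /(congr1 (@Normc.normc R)); rewrite Normc.normc0 /= addrC.
  by rewrite addrC cos2Dsin2 sqrtr1 => /eqP; rewrite oner_eq0.
have t0' : t%:C != 0 by apply: contra t0 => /eqP/complexI ->.
have -> : (r / t)%:C = r%:C / t%:C by exact: fmorph_div.
have -> : expi a = expi (a - b) * expi b by rewrite -expiD subrK.
field.
by rewrite t0' b0.
Qed.

Lemma polar_div (x y : R[i]) : upper_half_plane x -> upper_half_plane y ->
  x / y = (normc x / normc y)%:C * expi (carg x - carg y).
Proof.
move=> xu yu; rewrite -expi_div; first by rewrite -!polar.
by rewrite gt_eqF // normc_gt0 upper_neq0.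
Qed.

Lemma normc_polar (r a : R) : 0 <= r -> normc (r%:C * expi a) = r.
Proof.
by move=> r0; rewrite Normc.normcM normc_real ger0_norm //= cos2Dsin2 sqrtr1 mulr1.
Qed.

Lemma Re_polar (r a : R) : complex.Re (r%:C * expi a) = r * cos a.
Proof. by rewrite /= mul0r subr0. Qed.
End PolarQuotients.

(** * The Dyson equation at a fixed spectral parameter *)

Section FixedPoint.
Context {R : realType} {n : nat} (S : 'M[R]_n) (z : R[i]) (v : 'I_n -> R[i]).
Local Notation Re := complex.Re.
Local Notation Im := complex.Im.
Local Notation normc := Normc.normc.

Hypothesis S_sym : S^T = S.
Hypothesis S_ge0 : forall i j, 0 <= S i j.
Hypothesis z_up : upper_half_plane z.
Hypothesis v_up : forall k, upper_half_plane (v k).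
Hypothesis dyson : forall k, - (v k)^-1 = z + \sum_j (S k j)%:C * v j.

(** The name refers to the bound by 1 of [saturation_le1], which the
    anti-diagonal entries reach in the limit. *)
Definition saturation k j : R := normc (v k) * S k j * normc (v j).
Definition cosv k : R := Re (v k) / normc (v k).
Definition sinv k : R := Im (v k) / normc (v k).

Let M_gt0 k : 0 < normc (v k).
Proof. by rewrite normc_gt0 upper_neq0. Qed.

Lemma saturation_sym i j : saturation i j = saturation j i.
Proof. by rewrite /saturation -{1}S_sym mxE; ring. Qed.

Lemma saturation_ge0 i j : 0 <= saturation i j.
Proof. by rewrite !mulr_ge0 ?S_ge0 ?normc_ge0. Qed.

Lemma sinv_gt0 k : 0 < sinv k.
Proof. by rewrite divr_gt0 ?M_gt0 ?v_up. Qed.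

Lemma cosv_sinv k : cosv k ^+ 2 + sinv k ^+ 2 = 1.
Proof.
rewrite /cosv /sinv !expr_div_n -mulrDl -normc_sqr divff //.
by rewrite expf_neq0 // gt_eqF.
Qed.

(** The Dyson equation multiplied by |v_k| reads, with e_k = v_k / |v_k|,
    - conj e = z |v| + F e. The product z |v_k| is split into the direction of z
    and the bounded quantity |z| |v_k|. *)
Lemma Re_dyson k :
  - cosv k = Re z / normc z * (normc z * normc (v k)) + mulv saturation cosv k.
Proof.
have /(congr1 (@complex.Re R)) := dyson k; rewrite cReN cReD cReV cRe_sum => h.
have -> : - cosv k = normc (v k) * - (Re (v k) / normc (v k) ^+ 2).
  by rewrite /cosv; field; rewrite gt_eqF.
rewrite h mulrDr; congr (_ + _).
  by field; rewrite gt_eqF // normc_gt0 upper_neq0.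
rewrite mulr_sumr; apply: eq_bigr => j _.
rewrite cReM /= mul0r subr0 /saturation /cosv; field.
by rewrite gt_eqF.
Qed.

Lemma Im_dyson k :
  sinv k = Im z / normc z * (normc z * normc (v k)) + mulv saturation sinv k.
Proof.
have /(congr1 (@complex.Im R)) := dyson k; rewrite cImN cImD cImV cIm_sum opprK => h.
have -> : sinv k = normc (v k) * (Im (v k) / normc (v k) ^+ 2).
  by rewrite /sinv; field; rewrite gt_eqF.
rewrite h mulrDr; congr (_ + _).
  by field; rewrite gt_eqF // normc_gt0 upper_neq0.
rewrite mulr_sumr; apply: eq_bigr => j _.
rewrite cImM /= mul0r addr0 /saturation /sinv; field.
by rewrite gt_eqF.
Qed.

(** The sines form a positive vector which, Im z being positive, F does not
    increase. *)
Lemma saturation_contraction : l2_contraction saturation.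
Proof.
apply: (@schur_test _ _ _ sinv) => [||k|k].
- exact: saturation_sym.
- exact: saturation_ge0.
- exact: sinv_gt0.
- rewrite [leRHS]Im_dyson lerDr; apply: mulr_ge0.
    by rewrite divr_ge0 ?normc_ge0 // ltW.
  by rewrite mulr_ge0 ?normc_ge0.
Qed.

Lemma saturation_le1 i j : saturation i j <= 1.
Proof.
by rewrite (le_trans (ler_norm _)) // contraction_entry //; exact: saturation_contraction.
Qed.

Lemma cosv_sinv_le1 k : (-1 <= cosv k <= 1) * (-1 <= sinv k <= 1).
Proof. by have := cosv_sinv k; split; apply/andP; split; nra. Qed.

Lemma dysonM k : -1 = z * v k + \sum_j (S k j)%:C * (v k * v j).
Proof.
have vk0 : v k != 0 by rewrite upper_neq0.
rewrite -(mulVf vk0) -mulNr dyson mulrDl mulr_suml; congr (_ + _).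
by apply: eq_bigr => j _; ring.
Qed.

(** In the equation multiplied by v_k, every term but z v_k is bounded by 1. *)
Lemma normM_le k : normc z * normc (v k) <= n.+1%:R.
Proof.
rewrite -Normc.normcM.
have -> : z * v k = -1 - \sum_j (S k j)%:C * (v k * v j).
  by rewrite [X in X - _](dysonM k) addrK.
rewrite (le_trans (le_normcD _ _)) // !normcN Normc.normc1 -addn1 natrD addrC.
rewrite lerD2r (le_trans (normc_sum _ _ _ _)) //.
have -> : n%:R = \sum_(j < n) (1 : R) by rewrite sumr_const card_ord.
apply: ler_sum => j _; apply: le_trans (saturation_le1 k j).
by rewrite !Normc.normcM normc_real ger0_norm // /saturation mulrCA mulrA.
Qed.
End FixedPoint.

(** * The saturation matrix near the origin *)

Section Saturation.
Context {R : realType} {n : nat} (S : 'M[R]_n) (m : R[i] -> 'cV[R[i]]_n).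
Local Notation normc := Normc.normc.

Hypothesis S_sym : S^T = S.
Hypothesis S_ge0 : forall i j, 0 <= S i j.
Hypothesis S_antidiag : forall i j : 'I_n, (i.+1 + j.+1 = n.+1)%N -> 0 < S i j.
Hypothesis S_eq0 : forall i j : 'I_n, (n.+2 <= i.+1 + j.+1)%N -> S i j = 0.
Hypothesis hm : dyson_solution S m.

Definition upper_nbhs0 : set_system R[i] :=
  within (@upper_half_plane R) (nbhs (0 : R[i]^o)).

#[global] Instance upper_nbhs0_filter : Filter upper_nbhs0.
Proof. exact: within_filter. Qed.

Lemma upper_nbhs0_up : upper_nbhs0 (@upper_half_plane R).
Proof. exact: withinT. Qed.

Lemma normc_cvg0 : normc z @[z --> upper_nbhs0] --> (0 : R).
Proof.
have : z @[z --> upper_nbhs0] --> (0 : R[i]^o) by exact: cvg_within.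
by move=> /cvg_complexP; under eq_fun do rewrite subr0.
Qed.

Let up_fact z : upper_half_plane z ->
  (forall k, upper_half_plane (m z k 0)) /\
  (forall k, - (m z k 0)^-1 = z + \sum_j (S k j)%:C * m z j 0).
Proof. by move=> zu; split=> k; have [] := hm _ zu k. Qed.

(** Along the ultrafilter all bounded quantities have limits, and the limits
    satisfy the hypotheses of [heavy_indices_vanish] and of
    [antitriangular_stochastic]. *)
Lemma ultra_offdiagonal U : UltraFilter U -> upper_nbhs0 `<=` U ->
  (forall k, normc z * normc (m z k 0) @[z --> U] --> (0 : R)) /\
  (forall i j : 'I_n, j != rev_ord i ->
     saturation S (fun k => m z k 0) i j @[z --> U] --> (0 : R)).
Proof.
move=> UU nU; have UF : ProperFilter U by exact: ultra_proper.
have Uup : U (@upper_half_plane R) by apply: nU; exact: upper_nbhs0_up.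
pose vv z k := m z k 0.
have bounded_cvg (h : R[i] -> R) a b :
    (forall z, upper_half_plane z -> a <= h z <= b) ->
    exists l : R, h z @[z --> U] --> l.
  move=> hab; apply: (@ultra_bounded_cvg _ _ _ _ a b) => //.
  by apply: (@filterS _ U _ _ _ _ Uup) => z /hab.
have [F HF] : exists F : 'I_n -> 'I_n -> R, forall i j,
    saturation S (vv z) i j @[z --> U] --> F i j.
  suff : forall p : 'I_n * 'I_n, exists l : R,
      saturation S (vv z) p.1 p.2 @[z --> U] --> l.
    by move=> /choice[h Hh]; exists (fun i j => h (i, j)) => i j; exact: (Hh (i, j)).
  move=> [i j]; apply: (bounded_cvg _ 0 1) => z zu /=.
  have [vu dy] := up_fact z zu.
  by rewrite saturation_ge0 // (saturation_le1 _ z).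
have /choice[g Hg] : forall k, exists l : R, cosv (vv z) k @[z --> U] --> l.
  move=> k; apply: (bounded_cvg _ (-1) 1) => z zu.
  exact: (cosv_sinv_le1 _ (up_fact z zu).1 k).1.
have /choice[f Hf] : forall k, exists l : R, sinv (vv z) k @[z --> U] --> l.
  move=> k; apply: (bounded_cvg _ (-1) 1) => z zu.
  exact: (cosv_sinv_le1 _ (up_fact z zu).1 k).2.
have /choice[t Ht] : forall k, exists l : R,
    normc z * normc (vv z k) @[z --> U] --> l.
  move=> k; apply: (bounded_cvg _ 0 n.+1%:R) => z zu.
  have [vu dy] := up_fact z zu.
  by rewrite mulr_ge0 ?normc_ge0 //= (normM_le S).
(* The direction of z itself, seen as a vector with one entry. *)
pose z1 (z : R[i]) (k : 'I_1) := z.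
have z1u z : upper_half_plane z -> forall k, upper_half_plane (z1 z k) by [].
have [zr Hzr] : exists zr : R, cosv (z1 z) ord0 @[z --> U] --> zr.
  apply: (bounded_cvg _ (-1) 1) => z zu.
  exact: (cosv_sinv_le1 _ (z1u _ zu) ord0).1.
have [zi Hzi] : exists zi : R, sinv (z1 z) ord0 @[z --> U] --> zi.
  apply: (bounded_cvg _ (-1) 1) => z zu.
  exact: (cosv_sinv_le1 _ (z1u _ zu) ord0).2.
have Uz : normc z @[z --> U] --> (0 : R).
  by apply: cvg_trans normc_cvg0; exact: cvg_app.
have Fsym i j : F i j = F j i.
  apply: (cvg_near_unique _ _ _ _ _ _ (HF i j) (HF j i)); apply: (@filterE _ U) => z.
  exact: saturation_sym.
have F0 i j : 0 <= F i j.
  apply: (cvgr_to_ge (HF i j)); apply: (@filterE _ U) => z.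
  exact: saturation_ge0.
have cF : l2_contraction F.
  move=> x.
  have : \sum_k mulv (saturation S (vv z)) x k ^+ 2 @[z --> U] -->
         \sum_k mulv F x k ^+ 2.
    apply: (cvg_big add_continuous) => k _; rewrite expr2.
    under eq_fun do rewrite expr2.
    have cM : mulv (saturation S (vv z)) x k @[z --> U] --> mulv F x k.
      by apply: cvg_mulv => // j; exact: cvg_cst.
    exact: cvgM.
  move/cvgr_to_le; apply; apply: (@filterS _ U _ _ _ _ Uup) => z zu.
  have [vu dy] := up_fact z zu.
  exact: (@saturation_contraction _ _ S z).
have unit1 (a b : R[i] -> R) (x y : R) : a z @[z --> U] --> x ->
    b z @[z --> U] --> y ->
    U [set z | a z ^+ 2 + b z ^+ 2 = 1] -> x ^+ 2 + y ^+ 2 = 1.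
  move=> ax bY ab.
  have l1 : a z ^+ 2 + b z ^+ 2 @[z --> U] --> x ^+ 2 + y ^+ 2.
    rewrite !expr2; under eq_fun do rewrite !expr2.
    by apply: cvgD; exact: cvgM.
  have l2 : (1 : R) @[z --> U] --> (1 : R) by exact: cvg_cst.
  exact: (cvg_near_unique _ _ _ _ _ _ l1 l2 ab).
have gf1 k : g k ^+ 2 + f k ^+ 2 = 1.
  apply: (unit1 _ _ _ _ (Hg k) (Hf k)).
  apply: (@filterS _ U _ _ _ _ Uup) => z zu.
  exact: (cosv_sinv _ (up_fact z zu).1).
have z1' : zr ^+ 2 + zi ^+ 2 = 1.
  apply: (unit1 _ _ _ _ Hzr Hzi).
  apply: (@filterS _ U _ _ _ _ Uup) => z zu.
  exact: (cosv_sinv _ (z1u z zu) ord0).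
have eg k : - g k = zr * t k + mulv F g k.
  have l1 : - cosv (vv z) k @[z --> U] --> - g k by exact: cvgN.
  have l2 : cosv (z1 z) ord0 * (normc z * normc (vv z k)) +
      mulv (saturation S (vv z)) (cosv (vv z)) k @[z --> U] -->
      zr * t k + mulv F g k.
    by apply: cvgD; [exact: cvgM | exact: cvg_mulv].
  apply: (cvg_near_unique _ _ _ _ _ _ l1 l2).
  apply: (@filterS _ U _ _ _ _ Uup) => z zu.
  by have [vu dy] := up_fact z zu; exact: Re_dyson.
have ef k : f k = zi * t k + mulv F f k.
  have l2 : sinv (z1 z) ord0 * (normc z * normc (vv z k)) +
      mulv (saturation S (vv z)) (sinv (vv z)) k @[z --> U] -->
      zi * t k + mulv F f k.
    by apply: cvgD; [exact: cvgM | exact: cvg_mulv].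
  apply: (cvg_near_unique _ _ _ _ _ _ (Hf k) l2).
  apply: (@filterS _ U _ _ _ _ Uup) => z zu.
  by have [vu dy] := up_fact z zu; exact: Im_dyson.
have t_ge0 k : 0 <= t k.
  apply: (cvgr_to_ge (Ht k)); apply: (@filterE _ U) => z.
  by rewrite mulr_ge0 ?normc_ge0.
have sg k : 0 < S k (rev_ord k).
  by apply: S_antidiag => /=; have := ltn_ord k; lia.
have FR z k : upper_half_plane z -> S k (rev_ord k) *
    (normc (vv z k) * normc (vv z (rev_ord k))) <= 1.
  move=> zu; have [vu dy] := up_fact z zu.
  have := @saturation_le1 _ _ S z _ S_sym S_ge0 zu vu dy k (rev_ord k).
  by rewrite /saturation; apply: le_trans; rewrite le_eqVlt; apply/orP; left; apply/eqP; ring.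
(* If |z| M_k stays away from 0, then M_k is at least of order 1/|z|, and as the
   anti-diagonal entries of F are at most 1 the index n+1-k has M of order at
   most |z|. This makes both |z| M_(n+1-k) and F_(n+1-k,l) negligible, the latter
   when |z| M_l is. *)
have trev k : 0 < t k -> t (rev_ord k) = 0.
  move=> tk.
  have l1 : S k (rev_ord k) * (normc z * normc (vv z k) *
      (normc z * normc (vv z (rev_ord k)))) @[z --> U] -->
      S k (rev_ord k) * (t k * t (rev_ord k)).
    by apply: cvgM; [exact: cvg_cst | exact: cvgM].
  have l2 : normc z * normc z @[z --> U] --> (0 * 0 : R) by exact: cvgM.
  have : S k (rev_ord k) * (t k * t (rev_ord k)) <= 0 * 0.
    apply: (cvg_near_le _ _ _ _ _ _ l1 l2); apply: (@filterS _ U _ _ _ _ Uup) => z zu /=.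
    have -> : S k (rev_ord k) * (normc z * normc (vv z k) *
      (normc z * normc (vv z (rev_ord k)))) = normc z * normc z *
      (S k (rev_ord k) * (normc (vv z k) * normc (vv z (rev_ord k)))) by ring.
    by rewrite ler_piMr ?mulr_ge0 ?normc_ge0 ?FR.
  rewrite mul0r !pmulr_rle0 // => h; apply/eqP.
  by rewrite eq_le h t_ge0.
have Frev k l : 0 < t k -> t l = 0 -> F (rev_ord k) l = 0.
  move=> tk tl.
  have l1 : S k (rev_ord k) * (normc z * normc (vv z k) *
      saturation S (vv z) (rev_ord k) l) @[z --> U] -->
      S k (rev_ord k) * (t k * F (rev_ord k) l).
    by apply: cvgM; [exact: cvg_cst | exact: cvgM].
  have l2 : S (rev_ord k) l * (normc z * normc (vv z l)) @[z --> U] -->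
      S (rev_ord k) l * t l.
    by apply: cvgM; [exact: cvg_cst|].
  have : S k (rev_ord k) * (t k * F (rev_ord k) l) <= S (rev_ord k) l * t l.
    apply: (cvg_near_le _ _ _ _ _ _ l1 l2); apply: (@filterS _ U _ _ _ _ Uup) => z zu /=.
    have -> : S k (rev_ord k) * (normc z * normc (vv z k) *
      saturation S (vv z) (rev_ord k) l) =
      S (rev_ord k) l * (normc z * normc (vv z l)) *
      (S k (rev_ord k) * (normc (vv z k) * normc (vv z (rev_ord k)))).
      by rewrite /saturation; ring.
    by rewrite ler_piMr ?mulr_ge0 ?normc_ge0 ?FR.
  rewrite tl mulr0 !pmulr_rle0 // => h; apply/eqP.
  by rewrite eq_le h F0.
have t_eq0 := @heavy_indices_vanish _ _ F g f t zr zi (@rev_ord n)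
  Fsym F0 cF gf1 z1' eg ef rev_ordK t_ge0 trev Frev.
split=> [k|i j ij]; first by rewrite -(t_eq0 k); exact: Ht.
have F1 : forall k, \sum_j F k j = 1.
  apply: (@row_sums_eq1 _ _ F g f) => // k.
    by rewrite eg t_eq0 mulr0 add0r.
  by rewrite [LHS]ef t_eq0 mulr0 add0r.
have Ftri (a b : 'I_n) : (n <= a + b)%N -> F a b = 0.
  move=> ab; apply: (cvg_near_unique _ _ _ _ _ _ (HF a b) (cvg_cst 0)).
  apply: (@filterE _ U) => z /=.
  by rewrite /saturation S_eq0 ?mulr0 ?mul0r //; lia.
rewrite -(@antitriangular_stochastic _ _ F Fsym F0 F1 Ftri i j ij).
exact: HF.
Qed.

Lemma offdiagonal_cvg0 :
  (forall k, normc z * normc (m z k 0) @[z --> upper_nbhs0] --> (0 : R)) /\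
  (forall i j : 'I_n, j != rev_ord i ->
     saturation S (fun k => m z k 0) i j @[z --> upper_nbhs0] --> (0 : R)).
Proof.
split=> [k|i j ij]; apply: cvg_ultra => U UU nU.
  exact: (ultra_offdiagonal U UU nU).1.
exact: (ultra_offdiagonal U UU nU).2.
Qed.
End Saturation.

(** * Ratios of consecutive components *)

(** Only algebra is used here: a family w_0, ..., w_(n+1) whose products satisfy
    the quadratic equations below, the products above the anti-diagonal being
    negligible. *)
Section Ratios.
Context {K : numFieldType} {T : Type} (F : set_system T) {FF : Filter F}.

Lemma cvg_near_eq (f g : T -> K) (l : K) :
  F [set x | f x = g x] -> f x @[x --> F] --> l -> g x @[x --> F] --> l.
Proof.
move=> fg; apply: cvg_trans; apply: near_eq_cvg.
by move: fg; apply: filterS => x /= ->.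
Qed.

Context (n : nat) (s : nat -> nat -> K) (w : nat -> T -> K).
Hypothesis n_gt0 : (0 < n)%N.
Hypothesis s_sym : forall i j, s i j = s j i.
Hypothesis s0 : forall k, s k 0%N = 1.
Hypothesis s_antidiag : forall k, (k <= n.+1)%N -> s k (n.+1 - k)%N != 0.
Hypothesis s_antidiag_prev : forall k, (k <= n)%N -> s k (n - k)%N != 0.
Hypothesis w_neq0 : F [set x | forall k, (k <= n.+1)%N -> w k x != 0].
Hypothesis w_ends : F [set x | w 0%N x * w n.+1 x = -1].
Hypothesis dyson : F [set x | forall k, (0 < k <= n)%N ->
  \sum_(j < n.+2 - k) s k j * (w k x * w j x) = -1].
Hypothesis off_cvg0 : forall k j, (0 < k)%N -> (k + j <= n)%N ->
  s k j * (w k x * w j x) @[x --> F] --> (0 : K).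

(** The products along the anti-diagonal and along the line above it, and the
    part of row k that lies strictly above the anti-diagonal. *)
Let Q k x := w k x * w (n.+1 - k)%N x.
Let P k x := w k x * w (n - k)%N x.
Let D k x := \sum_(j < n.+1 - k) s k j * (w k x * w j x).

Let cvg_sum0 N (f : nat -> T -> K) : (forall j, (j < N)%N -> f j x @[x --> F] --> (0 : K)) ->
  \sum_(j < N) f j x @[x --> F] --> (0 : K).
Proof.
move=> f0; rewrite [X in _ --> X](_ : _ = \sum_(j < N) (0 : K)); last by rewrite big1.
by apply: (cvg_big add_continuous) => j _; exact: f0.
Qed.

Let D_Q : F [set x | forall k, (0 < k <= n)%N -> D k x = -1 - s k (n.+1 - k)%N * Q k x].
Proof.
move: dyson; apply: filterS => x h k kn; have := h k kn.
have -> : (n.+2 - k = (n.+1 - k).+1)%N by lia.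
by rewrite big_ord_recr /= => <-; rewrite addrK.
Qed.

(** The end cases are the exact relation w_0 w_(n+1) = -1. *)
Let Q_cvg k : (k <= n.+1)%N -> Q k x @[x --> F] --> - (s k (n.+1 - k)%N)^-1.
Proof.
move=> kn; have [k0|k0] := posnP k.
  apply: (@cvg_near_eq (fun=> -1)); last first.
    by rewrite k0 s_sym s0 invr1; exact: cvg_cst.
  by move: w_ends; apply: filterS => x /= <-; rewrite /Q k0 subn0.
have [kn1|kn1] := eqVneq k n.+1.
  apply: (@cvg_near_eq (fun=> -1)); last first.
    by rewrite kn1 subnn s0 invr1; exact: cvg_cst.
  by move: w_ends; apply: filterS => x /= <-; rewrite /Q kn1 subnn mulrC.
have kn' : (0 < k <= n)%N by lia.
apply: (@cvg_near_eq (fun x => (-1 - D k x) * (s k (n.+1 - k)%N)^-1)).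
  move: D_Q; apply: filterS => x /(_ k kn') /= ->.
  by rewrite opprB addrC subrK mulrC mulKf // s_antidiag.
have -> : - (s k (n.+1 - k)%N)^-1 = (-1 - 0) * (s k (n.+1 - k)%N)^-1.
  by rewrite subr0 mulN1r.
apply: cvgM; last exact: cvg_cst.
apply: cvgB; first exact: cvg_cst.
apply: (cvg_sum0 _ (fun j x => s k j * (w k x * w j x))) => j jn.
by apply: off_cvg0; lia.
Qed.

(** For k = 0 the product is P n, as P is symmetric. *)
Let P_cvg0 k : (k <= n)%N -> P k x @[x --> F] --> (0 : K).
Proof.
move=> kn.
have main j : (0 < j <= n)%N -> P j x @[x --> F] --> (0 : K).
  move=> /andP[j0 jn].
  apply: (@cvg_near_eq (fun x => s j (n - j)%N * P j x * (s j (n - j)%N)^-1)).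
    by apply: filterE => x; rewrite /= mulrC mulKf // s_antidiag_prev.
  rewrite -(mul0r (s j (n - j)%N)^-1); apply: cvgM; last exact: cvg_cst.
  by apply: off_cvg0 => //; lia.
have [k0|k0] := posnP k; last by apply: main; lia.
apply: (@cvg_near_eq (P n)); last by apply: main; lia.
by apply: filterE => x; rewrite /P /= k0 subn0 subnn mulrC.
Qed.

(** The quotient is P_k / Q_(k+1), as the factor w_(n-k) is common to both. *)
Let step_cvg0 k : (k <= n)%N -> w k x / w k.+1 x @[x --> F] --> (0 : K).
Proof.
move=> kn.
apply: (@cvg_near_eq (fun x => P k x * (Q k.+1 x)^-1)).
  move: w_neq0; apply: filterS => x /= h.
  rewrite /P /Q subSS; field.
  by rewrite !h //; lia.
rewrite -(mul0r (- (s k.+1 (n.+1 - k.+1)%N)^-1)^-1).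
apply: cvgM; first exact: P_cvg0.
apply: cvgV; last exact: Q_cvg.
by rewrite oppr_eq0 invr_eq0 s_antidiag.
Qed.

Let lower_cvg0 j k : (j < k <= n.+1)%N -> w j x / w k x @[x --> F] --> (0 : K).
Proof.
elim: k => // k IH /andP[]; rewrite ltnS leq_eqVlt => /orP[/eqP -> kn|jk kn].
  exact: step_cvg0.
apply: (@cvg_near_eq (fun x => w j x / w k x * (w k x / w k.+1 x))).
  move: w_neq0; apply: filterS => x /= h; field.
  by rewrite !h //; lia.
rewrite -(mulr0 0); apply: cvgM; last exact: step_cvg0.
by apply: IH; lia.
Qed.

(** As the w_j are of strictly increasing order, the last term of D dominates. *)
Let D_cvg k : (0 < k <= n)%N -> D k x / P k x @[x --> F] --> s k (n - k)%N.
Proof.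
move=> kn.
apply: (@cvg_near_eq (fun x => \sum_(j < n - k) s k j * (w j x / w (n - k)%N x)
                              + s k (n - k)%N)).
  move: w_neq0; apply: filterS => x /= h.
  rewrite /D (_ : (n.+1 - k = (n - k).+1)%N); last by lia.
  rewrite big_ord_recr /= mulrDl mulr_suml; congr (_ + _).
    by apply: eq_bigr => j _; rewrite /P; field; rewrite !h //; lia.
  by rewrite /P; field; rewrite !h //; lia.
have E : 0 + s k (n - k)%N = s k (n - k)%N by rewrite add0r.
rewrite -{2}E; apply: cvgD; last exact: cvg_cst.
apply: (cvg_sum0 _ (fun j x => s k j * (w j x / w (n - k)%N x))) => j jn.
rewrite -(mulr0 (s k j)); apply: cvgM; first exact: cvg_cst.
by apply: lower_cvg0; lia.
Qed.

(** By symmetry of Q and s, D_k and D_(n+1-k) are both equal to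
    -1 - s_(k,n+1-k) Q_k, while their dominant terms are P_k and P_(k-1) up to
    the coefficients. *)
Let P_step k : (0 < k <= n)%N ->
  P k x / P k.-1 x @[x --> F] --> s k.-1 (n - k.-1)%N / s k (n - k)%N.
Proof.
move=> kn; have l1 := D_cvg k kn.
have kn' : (0 < n.+1 - k <= n)%N by lia.
have l2 : D k x / P k.-1 x @[x --> F] --> s k.-1 (n - k.-1)%N.
  have -> : s k.-1 (n - k.-1)%N = s (n.+1 - k)%N (n - (n.+1 - k))%N.
    by rewrite s_sym; congr s; lia.
  apply: cvg_near_eq (D_cvg _ kn').
  move: D_Q; apply: filterS => x /= h.
  rewrite (h _ kn) (h _ kn') /P /Q.
  have -> : (n.+1 - (n.+1 - k) = k)%N by lia.
  have -> : (n - (n.+1 - k) = k.-1)%N by lia.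
  have -> : (n - k.-1 = n.+1 - k)%N by lia.
  by rewrite (s_sym k) (mulrC (w k x)) (mulrC (w k.-1 x)).
have s1 : s k (n - k)%N != 0 by apply: s_antidiag_prev; lia.
have D0 : F [set x | D k x / P k x != 0] by exact: (cvgr_neq0 _ l1).
apply: (@cvg_near_eq (fun x => (D k x / P k.-1 x) * (D k x / P k x)^-1)).
  move: w_neq0 D0; apply: filterS2 => x /= h.
  rewrite mulf_eq0 negb_or => /andP[d0 _].
  by rewrite /P; field; rewrite d0 !h //; lia.
by apply: cvgM => //; exact: cvgV.
Qed.

Let P_top k : (k <= n)%N -> P n x / P k x @[x --> F] --> s k (n - k)%N.
Proof.
move=> kn; rewrite -(subKn kn); move: (n - k)%N (leq_subr k n) => d.
elim: d => [|d IH] dn.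
  apply: (@cvg_near_eq (fun=> 1)).
    move: w_neq0; apply: filterS => x /= h.
    by rewrite subn0 divff // /P mulf_neq0 // h //; lia.
  by rewrite !subn0 subnn s0; exact: cvg_cst.
have e1 : ((n - d).-1 = n - d.+1)%N by lia.
apply: (@cvg_near_eq (fun x => (P n x / P (n - d)%N x)
                            * (P (n - d)%N x / P (n - d.+1)%N x))).
  move: w_neq0; apply: filterS => x /= h.
  by rewrite /P; field; rewrite !h //; lia.
have sd : s (n - d)%N (n - (n - d))%N != 0 by apply: s_antidiag_prev; lia.
rewrite -[s (n - d.+1)%N _](divfK sd) mulrC.
apply: cvgM; first by apply: IH; lia.
by rewrite -e1; apply: P_step; lia.
Qed.

(** The quotient w_(k+1) / w_k is Q_(k+1) / P_k, and w_(n+1) / w_n is -1 / P_n. *)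
Lemma ratio_cvg k : (k <= n)%N ->
  (w k.+1 x / w k x) / (w n.+1 x / w n x) @[x --> F] -->
  s k (n - k)%N / s k.+1 (n - k)%N.
Proof.
move=> kn.
apply: (@cvg_near_eq (fun x => (P n x / P k x) * - Q k.+1 x)).
  move: w_neq0 w_ends; apply: filterS2 => x /= h we.
  have w0n : w 0%N x != 0 by exact: h.
  have -> : w n.+1 x = - (w 0%N x)^-1 by rewrite -mulN1r -we mulrAC mulfV // mul1r.
  rewrite /P /Q subSS subnn; field.
  by rewrite w0n !h //; lia.
apply: cvgM; first exact: P_top.
rewrite -[(s k.+1 _)^-1]opprK; apply: cvgN.
by have := Q_cvg k.+1 kn; rewrite subSS.
Qed.
End Ratios.

(** * Moduli and phases of the solution *)

Section Asymptotics.
Context {R : realType} {p : nat} (S : 'M[R]_p.+1) (m : R[i] -> 'cV[R[i]]_p.+1).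
Local Notation normc := Normc.normc.
Local Notation n := p.+1.

Hypothesis S_sym : S^T = S.
Hypothesis S_ge0 : forall i j, 0 <= S i j.
Hypothesis S_antidiag_prev : forall i j : 'I_n, (i.+1 + j.+1 = n)%N -> 0 < S i j.
Hypothesis S_antidiag : forall i j : 'I_n, (i.+1 + j.+1 = n.+1)%N -> 0 < S i j.
Hypothesis S_eq0 : forall i j : 'I_n, (n.+2 <= i.+1 + j.+1)%N -> S i j = 0.
Hypothesis hm : dyson_solution S m.

(** With the values z at 0 and -1/z at n+1, indices start at 1 as on paper, the
    term z of the equation becomes the term j = 0 of the sum, and the products
    w_k w_(n+1-k) are close to constants for k = 0 and k = n+1 as well. *)
Definition ext_sol k (z : R[i]) : R[i] :=
  if k == 0%N then z else if k == n.+1 then - z^-1 else m z (inord k.-1) 0.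

Definition ext_coef i j : R :=
  if (i == 0%N) || (j == 0%N) then 1 else S (inord i.-1) (inord j.-1).

Local Notation w := ext_sol.
Local Notation s := ext_coef.

Lemma ext_sol_up z k : upper_half_plane z -> upper_half_plane (w k z).
Proof.
move=> zu; rewrite /ext_sol; case: eqP => // _; case: eqP => _.
  exact: upper_oppV.
by have [] := hm _ zu (inord k.-1).
Qed.

Lemma ext_sol_ends z : upper_half_plane z -> w 0 z * w n.+1 z = -1.
Proof. by move=> zu; rewrite /ext_sol /= eqxx mulrN divff // upper_neq0. Qed.

Lemma ext_sol_mid z k : (0 < k <= n)%N -> w k z = m z (inord k.-1) 0.
Proof.
move=> kn; rewrite /ext_sol; have -> : (k == 0%N) = false by lia.
by have -> : (k == n.+1) = false by lia.
Qed.

Lemma ext_coef_sym i j : s i j = s j i.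
Proof. by rewrite /ext_coef orbC -{1}S_sym mxE. Qed.

Lemma ext_coef0 k : s k 0%N = 1.
Proof. by rewrite /ext_coef orbT. Qed.

Lemma ext_coef_antidiag k : (k <= n.+1)%N -> 0 < s k (n.+1 - k)%N.
Proof.
move=> kn; rewrite /ext_coef; case: ifPn => // k0.
by apply: S_antidiag; rewrite !inordK; lia.
Qed.

Lemma ext_coef_antidiag_prev k : (k <= n)%N -> 0 < s k (n - k)%N.
Proof.
move=> kn; rewrite /ext_coef; case: ifPn => // k0.
by apply: S_antidiag_prev; rewrite !inordK; lia.
Qed.

Lemma ext_dyson z k : upper_half_plane z -> (0 < k <= n)%N ->
  \sum_(j < n.+2 - k) (s k j)%:C * (w k z * w j z) = -1.
Proof.
move=> zu kn.
have := @dysonM _ _ S z (fun k => m z k 0) (fun k => (hm _ zu k).1)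
  (fun k => (hm _ zu k).2) (inord k.-1).
move=> ->; rewrite -ext_sol_mid //.
rewrite (_ : (n.+2 - k)%N = (n.+1 - k).+1); last by lia.
rewrite big_ord_recl ext_coef0 mul1r mulrC; congr (_ + _).
rewrite (big_ord_widen_cond n xpredT (fun j => (s k j.+1)%:C * (w k z * w j.+1 z))) /=; last by lia.
rewrite big_mkcond /=; apply: eq_bigr => j _.
have jn := ltn_ord j.
rewrite (ext_sol_mid z j.+1) //= inord_val.
case: ifPn => jk.
  by rewrite /ext_coef orbF (_ : (k == 0)%N = false) ?inord_val //; lia.
by rewrite S_eq0 ?mul0r // inordK; lia.
Qed.

Lemma ext_off_cvg0 k j : (0 < k)%N -> (k + j <= n)%N ->
  (s k j)%:C * (w k z * w j z) @[z --> upper_nbhs0] --> (0 : R[i]^o).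
Proof.
move=> k0 kjn; apply/cvg_complexP; under eq_fun do rewrite subr0 !Normc.normcM normc_real.
have [off1 off2] := offdiagonal_cvg0 S m S_sym S_ge0 S_antidiag S_eq0 hm.
have [j0|j0] := posnP j.
  rewrite j0 ext_coef0 normr1.
  have := off1 (inord k.-1); apply: cvg_trans; apply: near_eq_cvg.
  by apply: filterE => z; rewrite mul1r mulrC (ext_sol_mid z k) //; lia.
rewrite /ext_coef.
have -> : (k == 0)%N || (j == 0)%N = false by lia.
rewrite ger0_norm //.
have kj : inord j.-1 != rev_ord (inord k.-1 : 'I_n).
  by apply/eqP => /(congr1 val) /=; rewrite !inordK; lia.
have := off2 _ _ kj; apply: cvg_trans; apply: near_eq_cvg; apply: filterE => z.
by rewrite /saturation !ext_sol_mid; [ring|lia|lia].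
Qed.

Lemma ext_ratio_cvg k : (k <= n)%N ->
  (w k.+1 z / w k z) / (w n.+1 z / w n z) @[z --> upper_nbhs0] -->
  ((s k (n - k)%N / s k.+1 (n - k)%N)%:C : R[i]^o).
Proof.
move=> kn.
have Fu : upper_nbhs0 (@upper_half_plane R) := upper_nbhs0_up.
have pos0 (x : R) : 0 < x -> x%:C != 0.
  by move=> x0; apply/eqP => /complexI h; move: x0; rewrite h ltxx.
have -> : (s k (n - k)%N / s k.+1 (n - k)%N)%:C
        = (s k (n - k)%N)%:C / (s k.+1 (n - k)%N)%:C by exact: fmorph_div.
apply: (@ratio_cvg R[i] _ upper_nbhs0 _ n (fun i j => (s i j)%:C) w) => //.
- by move=> i j; rewrite ext_coef_sym.
- by move=> i; rewrite ext_coef0.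
- by move=> i /ext_coef_antidiag /pos0.
- by move=> i /ext_coef_antidiag_prev /pos0.
- move: Fu; apply: filterS => z zu i _; apply: upper_neq0; exact: ext_sol_up.
- by move: Fu; apply: filterS => z zu /=; exact: ext_sol_ends.
- by move: Fu; apply: filterS => z zu i kin; exact: ext_dyson.
- exact: ext_off_cvg0.
Qed.

Definition limit_ratio k : R := ext_coef k (n - k)%N / ext_coef k.+1 (n - k)%N.
Definition increment k z : R := carg (w k.+1 z) - carg (w k z).
(** Moduli are taken relative to the last quotient w_(n+1) / w_n because this is
    the one whose argument is controlled, by [increment_last_bound]. *)
Definition rel_modulus k z : R :=
  (normc (w k.+1 z) / normc (w k z)) / (normc (w n.+1 z) / normc (w n z)).

Lemma limit_ratio_gt0 k : (k <= n)%N -> 0 < limit_ratio k.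
Proof.
move=> kn; apply: divr_gt0; first exact: ext_coef_antidiag_prev.
by have := ext_coef_antidiag k.+1 kn; rewrite subSS.
Qed.

Let normw_gt0 z k : upper_half_plane z -> 0 < normc (w k z).
Proof.
by move=> zu; rewrite normc_gt0; apply: upper_neq0; exact: ext_sol_up.
Qed.

Lemma rel_modulus_gt0 z k : upper_half_plane z -> 0 < rel_modulus k z.
Proof. by move=> zu; rewrite !divr_gt0 ?normw_gt0. Qed.

Lemma ratio_polar z k : upper_half_plane z ->
  (w k.+1 z / w k z) / (w n.+1 z / w n z) =
  (rel_modulus k z)%:C * expi (increment k z - increment n z).
Proof.
move=> zu; have wu j : upper_half_plane (w j z) by exact: ext_sol_up.
rewrite (polar_div (w k.+1 z)) // (polar_div (w n.+1 z)) // expi_div //.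
by rewrite gt_eqF // divr_gt0 ?normw_gt0.
Qed.

Lemma rel_modulus_cvg k : (k <= n)%N ->
  rel_modulus k z @[z --> upper_nbhs0] --> limit_ratio k.
Proof.
move=> kn; have l0 := limit_ratio_gt0 k kn.
have := ext_ratio_cvg k kn.
move/normc_cvg; rewrite normc_real ger0_norm ?ltW //.
apply: cvg_trans; apply: near_eq_cvg.
have Fu : upper_nbhs0 (@upper_half_plane R) := upper_nbhs0_up.
move: Fu; apply: filterS => z zu /=.
by rewrite ratio_polar // normc_polar // ltW // rel_modulus_gt0.
Qed.

Lemma cos_increment_cvg k : (k <= n)%N ->
  cos (increment k z - increment n z) @[z --> upper_nbhs0] --> (1 : R).
Proof.
move=> kn; have l0 := limit_ratio_gt0 k kn.
have := ext_ratio_cvg k kn.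
move/Re_cvg => l1.
have l2 : (rel_modulus k z)^-1 @[z --> upper_nbhs0] --> (limit_ratio k)^-1.
  by apply: cvgV; [exact: lt0r_neq0 | exact: rel_modulus_cvg].
have l3 : complex.Re ((w k.+1 z / w k z) / (w n.+1 z / w n z))
    * (rel_modulus k z)^-1 @[z --> upper_nbhs0] -->
    limit_ratio k * (limit_ratio k)^-1 by exact: cvgM.
rewrite divff ?gt_eqF // in l3; move: l3.
apply: cvg_trans; apply: near_eq_cvg.
have Fu : upper_nbhs0 (@upper_half_plane R) := upper_nbhs0_up.
move: Fu; apply: filterS => z zu /=.
rewrite ratio_polar // Re_polar mulrC mulrA mulVf ?mul1r //.
by rewrite gt_eqF // rel_modulus_gt0.
Qed.

(** Row n of the equation only contains the entries j = 0 and j = 1, so that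
    1 + w_0 w_n is, up to sign, a number of modulus F_n1, at most 1. *)
Lemma Re_last_le0 z : upper_half_plane z -> complex.Re (w 0 z * w n z) <= 0.
Proof.
move=> zu.
have := ext_dyson z n zu; rewrite leqnn /= => /(_ isT).
rewrite (_ : (n.+2 - n)%N = 2); last by lia.
rewrite big_ord_recl big_ord1 /= ext_coef0 mul1r mulrC.
set x := w 0 z * w n z => E.
set y := (ext_coef n 1)%:C * _ in E.
have ny : normc y <= 1.
  have vu k := (hm _ zu k).1; have dy k := (hm _ zu k).2.
  have := @saturation_le1 _ _ S z (fun k => m z k 0) S_sym S_ge0 zu vu dy
    (inord n.-1) (inord 0).
  rewrite /y !Normc.normcM normc_real /saturation.
  rewrite !ext_sol_mid ?leqnn //= /ext_coef /= ger0_norm //.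
  by apply: le_trans; rewrite le_eqVlt; apply/orP; left; apply/eqP; ring.
have yE : y = -1 - x by rewrite -E addrAC subrr add0r.
have : normc y ^+ 2 <= 1 by rewrite expr_le1 ?normc_ge0.
rewrite normc_sqr yE cReD cImD !cReN !cImN /=.
have := sqr_ge0 (complex.Re x); have := sqr_ge0 (complex.Im x); lra.
Qed.

Lemma increment_bound z k : upper_half_plane z -> `|increment k z| < pi.
Proof.
move=> zu.
have /andP[a1 a2] := carg_upper _ (ext_sol_up z k zu).
have /andP[b1 b2] := carg_upper _ (ext_sol_up z k.+1 zu).
by rewrite /increment ltr_norml; apply/andP; split; lra.
Qed.

(** This increment is pi - arg z - arg w_n, the argument of -1 / (w_0 w_n). *)
Lemma increment_last_bound z : upper_half_plane z -> `|increment n z| <= pi / 2.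
Proof.
move=> zu; apply: cos_ge0_le_pihalf; first by apply: ltW; exact: increment_bound.
have wu k : upper_half_plane (w k z) by exact: ext_sol_up.
have u0 : 0 < normc (w 0 z) * normc (w n z) by rewrite mulr_gt0 ?normw_gt0.
have := Re_last_le0 z zu.
rewrite (polar _ (wu 0%N)) (polar _ (wu n)).
set a := carg _; set b := carg _.
have -> : (normc (w 0 z))%:C * expi a * ((normc (w n z))%:C * expi b)
   = (normc (w 0 z) * normc (w n z))%:C * expi (a + b).
  rewrite expiD (rmorphM (real_complex R)) /=; ring.
rewrite Re_polar pmulr_rle0 // => cab.
have -> : increment n z = - (a + b) + pi.
  rewrite /increment {1}/ext_sol /= eqxx carg_oppV // -/b -[carg z]/a; ring.
by rewrite cosDpi cosN oppr_ge0.
Qed.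

Lemma increment_cvg k : (k <= n)%N ->
  increment k z - increment n z @[z --> upper_nbhs0] --> (0 : R).
Proof.
move=> kn; apply: cvg0_of_cos; last exact: cos_increment_cvg.
have Fu : upper_nbhs0 (@upper_half_plane R) := upper_nbhs0_up.
move: Fu; apply: filterS => z zu /=.
rewrite (le_lt_trans (ler_normB _ _)) // ltr_leD ?increment_bound //.
exact: increment_last_bound.
Qed.

Lemma prod_rel_modulus z k : upper_half_plane z ->
  \prod_(i < k) rel_modulus i z =
  normc (w k z) / (normc z * (normc (w n.+1 z) / normc (w n z)) ^+ k).
Proof.
move=> zu; have w0 j : normc (w j z) != 0 by rewrite gt_eqF ?normw_gt0.
have z0 : normc z != 0 := w0 0%N.
elim: k => [|k IH]; first by rewrite big_ord0 expr0 mulr1 divff.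
rewrite big_ord_recr /= IH /rel_modulus exprS; field.
by rewrite !w0 z0 expf_neq0 //= mulf_neq0 ?invr_eq0.
Qed.

Lemma sum_increment z k :
  \sum_(i < k) (increment i z - increment n z) =
  carg (w k z) - carg z - k%:R * increment n z.
Proof.
elim: k => [|k IH]; first by rewrite big_ord0 mul0r subr0 subrr.
by rewrite big_ord_recr /= IH -(natr1 k) [increment k z]/increment; ring.
Qed.

(** The telescoping products express |w_k| and |w_(n+1)| = 1/|z| through |z| and
    the last quotient; eliminating the latter leaves quantities that converge. *)
Lemma modulus_identity z k : upper_half_plane z ->
  normc (w k z) * normc z `^ (- (1 - 2 * k%:R / n.+1%:R)) =
  \prod_(i < k) rel_modulus i z
  * (\prod_(i < n.+1) rel_modulus i z) `^ (- (k%:R / n.+1%:R)).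
Proof.
move=> zu; have w0 j : 0 < normc (w j z) by exact: normw_gt0.
have z0 : 0 < normc z := w0 0%N.
set U := normc (w n.+1 z) / normc (w n z).
have U0 : 0 < U by rewrite divr_gt0.
rewrite !prod_rel_modulus // -/U.
have -> : normc (w n.+1 z) = (normc z)^-1.
  by rewrite /ext_sol /= eqxx normcN Normc.normcV.
have E x a : 0 < x -> x `^ a = expR (a * ln x) by move=> x0; rewrite /powR gt_eqF.
have zU j : 0 < normc z * U ^+ j by rewrite mulr_gt0 ?exprn_gt0.
rewrite !E ?divr_gt0 ?invr_gt0 //.
rewrite ln_div ?posrE ?invr_gt0 // lnV ?posrE // lnM ?posrE ?exprn_gt0 // lnXn //.
rewrite -[in RHS]mulrA; congr (_ * _).
have -> : (normc z * U ^+ k)^-1 = expR (- (ln (normc z) + ln U *+ k)).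
  by rewrite expRN -lnXn // -lnM ?posrE ?exprn_gt0 // lnK // posrE.
rewrite -expRD; congr expR.
rewrite -[ln U *+ n.+1]mulr_natr -[ln U *+ k]mulr_natr; field.
by rewrite -natrD pnatr_eq0.
Qed.

(** The additive counterpart of [modulus_identity]: arg w_(n+1) = pi - arg z
    determines the last increment, up to the deviations of the others. *)
Lemma phase_identity z k : upper_half_plane z ->
  carg (w k z) - (1 - 2 * k%:R / n.+1%:R) * carg z =
  pi * k%:R / n.+1%:R + (\sum_(i < k) (increment i z - increment n z)
   - k%:R / n.+1%:R * \sum_(i < n.+1) (increment i z - increment n z)).
Proof.
move=> zu; rewrite !sum_increment.
have -> : carg (w n.+1 z) = pi - carg z.
  by rewrite /ext_sol /= eqxx carg_oppV.
by field; rewrite -natrD pnatr_eq0.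
Qed.

(** The value of the right-hand side of [modulus_identity] in the limit. *)
Definition limit_modulus k : R := \prod_(i < k) limit_ratio i
  * (\prod_(i < n.+1) limit_ratio i) `^ (- (k%:R / n.+1%:R)).

Lemma prod_limit_gt0 k : (k <= n.+1)%N -> 0 < \prod_(i < k) limit_ratio i.
Proof.
by move=> kn; apply: prodr_gt0 => i _; apply: limit_ratio_gt0; have := ltn_ord i; lia.
Qed.

Lemma prod_rel_modulus_cvg k : (k <= n.+1)%N ->
  \prod_(i < k) rel_modulus i z @[z --> upper_nbhs0] --> \prod_(i < k) limit_ratio i.
Proof.
move=> kn; apply: (cvg_big mul_continuous) => i _.
by apply: rel_modulus_cvg; have := ltn_ord i; lia.
Qed.

Lemma sum_increment_cvg k : (k <= n.+1)%N ->
  \sum_(i < k) (increment i z - increment n z) @[z --> upper_nbhs0] --> (0 : R).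
Proof.
move=> kn.
have := cvg_big (r := index_enum 'I_k) (P := xpredT) (x0 := 0 : R) add_continuous
 (Ff := fun (i : 'I_k) z => increment i z - increment n z) (Fa := fun=> 0 : R) (F := upper_nbhs0).
rewrite big1 //; apply => i _.
by apply: increment_cvg; have := ltn_ord i; lia.
Qed.

Lemma ext_sol_cvg k : (k <= n)%N ->
  w k z * cpow z (- (1 - 2 * k%:R / n.+1%:R)) @[z --> upper_nbhs0] -->
  ((limit_modulus k)%:C * expi (pi * k%:R / n.+1%:R) : R[i]^o).
Proof.
move=> kn.
set a := 1 - 2 * k%:R / n.+1%:R.
have l1 : normc (w k z) * normc z `^ (- a) @[z --> upper_nbhs0] --> limit_modulus k.
  have l : \prod_(i < k) rel_modulus i z
    * (\prod_(i < n.+1) rel_modulus i z) `^ (- (k%:R / n.+1%:R))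
    @[z --> upper_nbhs0] --> limit_modulus k.
    apply: cvgM; first by apply: prod_rel_modulus_cvg; lia.
    by apply: powR_cvg; [exact: prod_limit_gt0 | exact: prod_rel_modulus_cvg].
  move: l; apply: cvg_trans; apply: near_eq_cvg.
  have Fu : upper_nbhs0 (@upper_half_plane R) := upper_nbhs0_up.
  by move: Fu; apply: filterS => z zu /=; rewrite modulus_identity.
have l2 : carg (w k z) - a * carg z @[z --> upper_nbhs0] --> pi * k%:R / n.+1%:R.
  have l : pi * k%:R / n.+1%:R + (\sum_(i < k) (increment i z - increment n z)
   - k%:R / n.+1%:R * \sum_(i < n.+1) (increment i z - increment n z))
     @[z --> upper_nbhs0] --> pi * k%:R / n.+1%:R + (0 - k%:R / n.+1%:R * 0).
    apply: cvgD; first exact: cvg_cst.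
    apply: cvgB; first by apply: sum_increment_cvg; lia.
    by apply: cvgM; [exact: cvg_cst | exact: sum_increment_cvg].
  rewrite mulr0 subr0 addr0 in l.
  move: l; apply: cvg_trans; apply: near_eq_cvg.
  have Fu : upper_nbhs0 (@upper_half_plane R) := upper_nbhs0_up.
  by move: Fu; apply: filterS => z zu /=; rewrite phase_identity.
have l3 : (normc (w k z) * normc z `^ (- a))%:C * expi (carg (w k z) - a * carg z)
    @[z --> upper_nbhs0] -->
    ((limit_modulus k)%:C * expi (pi * k%:R / n.+1%:R) : R[i]^o).
  by apply: (@cvgM R[i]); [exact: real_complex_cvg | exact: expi_cvg].
move: l3; apply: cvg_trans; apply: near_eq_cvg.
have Fu : upper_nbhs0 (@upper_half_plane R) := upper_nbhs0_up.
move: Fu; apply: filterS => z zu /=.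
rewrite {3}(polar _ (ext_sol_up z k zu)) /cpow mulNr expiD.
rewrite (rmorphM (real_complex R)) /=; ring.
Qed.
End Asymptotics.

Theorem theorem1p3 (R : realType) (n : nat) (hn : (1 <= n)%N) (S : 'M[R]_n)
  (S_sym : S^T = S)
  (S_ge0 : forall i j : 'I_n, 0 <= S i j)
  (S_antidiag_prev : forall i j : 'I_n, (i.+1 + j.+1 = n)%N -> 0 < S i j)
  (S_antidiag : forall i j : 'I_n, (i.+1 + j.+1 = n.+1)%N -> 0 < S i j)
  (S_eq0 : forall i j : 'I_n, (n.+2 <= i.+1 + j.+1)%N -> S i j = 0)
  (m : R[i] -> 'cV[R[i]]_n) (hm : dyson_solution S m) :
  exists c : 'I_n -> R,
    (forall k, 0 < c k) /\
    forall k : 'I_n,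
      m z k 0 * cpow z (- (1 - 2 * k.+1%:R / n.+1%:R))
        @[z --> within (@upper_half_plane R) (nbhs (0 : R[i]^o))]
      --> ((c k)%:C * expi (pi * k.+1%:R / n.+1%:R) : R[i]^o).
Proof.
case: n => [//|p] in hn S S_sym S_ge0 S_antidiag_prev S_antidiag S_eq0 m hm *.
exists (fun k => limit_modulus S k.+1); split=> k.
  rewrite mulr_gt0 //; first by apply: prod_limit_gt0 => //; have := ltn_ord k; lia.
  by rewrite powR_gt0 // prod_limit_gt0.
have kn : (0 < k.+1 <= p.+1)%N by have := ltn_ord k; lia.
have := ext_sol_cvg S m S_sym S_ge0 S_antidiag_prev S_antidiag S_eq0 hm k.+1 (ltn_ord k).
apply: cvg_trans; apply: near_eq_cvg; apply: filterE => z.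
by rewrite ext_sol_mid //= inord_val.
Qed.
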